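(* Suppose that $p,r$ are real numbers with $p\ge 1$ and $-1\le r\le p-1$. Then there exists a unique probability measure $\nu(p,r)$, with support contained in $[0,c(p)]$, such that $\left\{\binom{mp+r}{m}\right\}_{m=0}^{\infty}$ is its moment sequence, i.e. $\int x^m\,d\nu(p,r)(x)=\binom{mp+r}{m}$ for all $m=0,1,2,\ldots$.
   Context: For $a\in\mathbb{R}$ and $n\in\{0,1,2,\ldots\}$, $\binom{a}{n}:=a(a-1)\cdots(a-n+1)/n!$ (with $\binom{a}{0}=1$). For $p\ge1$, $c(p):=\dfrac{p^p}{(p-1)^{p-1}}$, where $0^0=1$, so that $c(1)=1$. *)

(* Defs.v *)
From HB Require Import structures.
From mathcomp Require Import all_boot all_order all_algebra.
From mathcomp Require Import all_classical all_reals all_analysis.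

Set Implicit Arguments.
Unset Strict Implicit.
Unset Printing Implicit Defensive.

Import Order.TTheory GRing.Theory Num.Theory.
Import numFieldNormedType.Exports.

Local Open Scope classical_set_scope.
Local Open Scope ring_scope.

Definition gbinom {R : realType} (a : R) (n : nat) : R :=
  (\prod_(i < n) (a - i%:R)) / (n`!)%:R.

(* [powR] satisfies 0 `^ 0 = 1, hence c_edge 1 = 1. *)
Definition c_edge {R : realType} (p : R) : R :=
  (p `^ p) / ((p - 1) `^ (p - 1)).

(* Topological support: the points all of whose open neighbourhoods have
   positive measure, i.e. the complement of the union of the null open sets. *)
Definition mtsupp {R : realType}
    (nu : {measure set (measurableTypeR R) -> \bar R}) : set R :=
  [set x : R | forall U : set R, open U -> U x -> (0 < nu U)%E].

Definition has_moments {R : realType}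
    (nu : {measure set (measurableTypeR R) -> \bar R}) (s : nat -> R) : Prop :=
  forall m : nat, (\int[nu]_x (x ^+ m)%:E)%E = (s m)%:E.

(* Uniqueness is equality on the Borel sets and not Leibniz equality: a
   [probability] is a function on all of [set R], whose values on
   non-measurable sets are not determined. *)
Definition exists_unique_probability {R : realType}
    (P : probability (measurableTypeR R) R -> Prop) : Prop :=
  exists nu : probability (measurableTypeR R) R,
    P nu /\
    forall nu' : probability (measurableTypeR R) R, P nu' ->
      forall A : set (measurableTypeR R), measurable A -> nu' A = nu A.

(* Main.v *)
Require Import Defs.
From HB Require Import structures.
From mathcomp Require Import all_boot all_order all_algebra.
From mathcomp Require Import all_classical all_reals all_analysis.
From mathcomp Require Import measurable_realfun ring lra zify.

Import Order.TTheory GRing.Theory Num.Theory.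
Import numFieldNormedType.Exports.

Local Open Scope classical_set_scope.
Local Open Scope ring_scope.

(* With s m = binom(m p + r, m) and c = c(p), the linear form sending 'X^m to
   s m is nonnegative on the polynomials that are nonnegative on [0, c].  Indeed
   s m / c^m is, up to normalization, the limit for M / N -> p - 1 of
     prod_{k=1..N} (m + k) * prod_{j=1..M} (m (p - 1) + r + j)
       / prod_{j=1..N+M} (m p + r + j).
   Viewed as a function of m, this has zeros at the -b and poles at the -a, where
   b runs over k and (r + j) / (p - 1), and a over (r + j) / p.  Because
   -1 < r <= p - 1, every x has at least as many a's as b's below it (in essence
   floor u + floor v <= floor (u + v)), so that the factors can be grouped into
   (m + b) / (m + a) = 1 + (b - a) / (m + a) with 0 < a <= b; multiplying the
   coefficient of 'X^m by such a factor preserves nonnegativity on [0, 1].  The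
   case r = -1 follows by continuity in r.
   A probability on [0, c] is then obtained from the positive form L through its
   distribution function F x = inf {L P | P >= 1_(t <= x) on [0, c]}. *)

(** * Multipliers preserving nonnegativity on the unit interval *)

Definition hadamard {R : nzRingType} (w : nat -> R) (P : {poly R}) : {poly R} :=
  \poly_(i < size P) (w i * P`_i).

Lemma coef_hadamard {R : nzRingType} (w : nat -> R) (P : {poly R}) i :
  (hadamard w P)`_i = w i * P`_i.
Proof.
rewrite coef_poly; case: ltnP => // iP.
by rewrite nth_default// mulr0.
Qed.

Definition nneg_on {R : numDomainType} (c : R) (P : {poly R}) :=
  forall x, 0 <= x <= c -> 0 <= P.[x].

Definition nneg_multiplier {R : numDomainType} (w : nat -> R) :=
  forall P : {poly R}, nneg_on 1 P -> nneg_on 1 (hadamard w P).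

(* At a minimum x of y on [0, 1] one has x y'(x) <= 0. *)
Lemma euler_ode_nneg {R : realType} (a : R) (y : {poly R}) :
  0 < a -> nneg_on 1 (a *: y + 'X * y^`()) -> nneg_on 1 y.
Proof.
move=> a0 hy.
have cy : {within `[0, 1], continuous (fun x : R => y.[x])}.
  by apply: continuous_subspaceT => x; exact: continuous_horner.
have [c c01 minc] := EVT_min ler01 cy.
move: c01; rewrite in_itv/= => c01.
suff yc0 : 0 <= y.[c].
  by move=> x x01; apply: le_trans yc0 _; apply: minc; rewrite in_itv.
(* With [y - y.[c] = q * ('X - c)], the derivative of [y] at [c] is [q.[c]]. *)
have /factor_theorem[q yq] : root (y - y.[c]%:P) c.
  by rewrite /root !hornerE subrr.
have dyc : (deriv y).[c] = q.[c].
  have -> : y = q * ('X - c%:P) + y.[c]%:P by rewrite -yq subrK.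
  rewrite derivD derivM derivC derivB derivX derivC !hornerE.
  by rewrite subrr mulr0 subr0 mulr1 add0r.
have yx x : y.[x] - y.[c] = q.[x] * (x - c).
  by have := congr1 (horner^~ x) yq; rewrite /= !hornerE.
have qc : c * q.[c] <= 0.
  have [->|c_neq0] := eqVneq c 0; first by rewrite mul0r.
  have c0 : 0 < c by rewrite lt_neqAle eq_sym c_neq0; case/andP: c01.
  rewrite pmulr_rle0// leNgt; apply/negP => qc0.
  (* If [q.[c] > 0], then [q > 0] just to the left of [c], and [y] drops there below its minimum. *)
  have : \forall t \near c^'-, 0 < q.[t].
    have /cvgr_gt : q.[t] @[t --> c^'-] --> q.[c].
      by apply: cvg_at_left_filter; exact: continuous_horner.
    by apply.
  move=> qpos.
  have [t [qt /andP[t0 tc]]] : exists t : R, 0 < q.[t] /\ 0 < t < c.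
    near c^'- => t; exists t; split; first by near: t.
    by apply/andP; split; near: t; [exact: nbhs_left_gt|exact: nbhs_left_lt].
  have : y.[c] <= y.[t].
    apply: minc; rewrite in_itv/= ltW//=.
    by case/andP: c01 => _; apply: le_trans; exact: ltW.
  by rewrite -subr_ge0 yx pmulr_rge0// subr_ge0 leNgt tc.
have := hy c c01; rewrite !hornerE dyc => h.
by rewrite -(pmulr_rge0 _ a0); lra.
Unshelve. all: by end_near. Qed.

Lemma nneg_multiplier_eq {R : numDomainType} {w1 w2 : nat -> R} :
  w1 =1 w2 -> nneg_multiplier w1 -> nneg_multiplier w2.
Proof. by move=> /funext ->. Qed.

Lemma nneg_multiplier_const {R : numDomainType} {c : R} :
  0 <= c -> nneg_multiplier (fun=> c).
Proof.
move=> c0 P hP x x01.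
have -> : hadamard (fun=> c) P = c *: P.
  by apply/polyP => i; rewrite coef_hadamard coefZ.
by rewrite hornerZ mulr_ge0// hP.
Qed.

Lemma nneg_multiplierD {R : numDomainType} {w1 w2 : nat -> R} :
  nneg_multiplier w1 -> nneg_multiplier w2 ->
  nneg_multiplier (fun m => w1 m + w2 m).
Proof.
move=> h1 h2 P hP x x01.
have -> : hadamard (fun m => w1 m + w2 m) P = hadamard w1 P + hadamard w2 P.
  by apply/polyP => i; rewrite coefD !coef_hadamard mulrDl.
by rewrite hornerD addr_ge0// ?h1 ?h2.
Qed.

Lemma nneg_multiplierM {R : numDomainType} {w1 w2 : nat -> R} :
  nneg_multiplier w1 -> nneg_multiplier w2 ->
  nneg_multiplier (fun m => w1 m * w2 m).
Proof.
move=> h1 h2 P hP.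
have -> : hadamard (fun m => w1 m * w2 m) P = hadamard w1 (hadamard w2 P).
  by apply/polyP => i; rewrite !coef_hadamard mulrA.
by apply: h1; exact: h2.
Qed.

Lemma nneg_multiplierV {R : realType} {a : R} :
  0 < a -> nneg_multiplier (fun m => (m%:R + a)^-1).
Proof.
move=> a0 P hP; apply: (@euler_ode_nneg _ a) => //.
suff -> : a *: hadamard (fun m => (m%:R + a)^-1) P +
    'X * (hadamard (fun m => (m%:R + a)^-1) P)^`() = P by [].
apply/polyP => i; rewrite coefD coefZ coefXM coef_deriv !coef_hadamard.
have ia : i%:R + a != 0 :> R by rewrite gt_eqF// ltr_wpDl.
case: i ia => [|i] ia; first by rewrite addr0 add0r mulrA divff ?mul1r// gt_eqF.
by rewrite /= -[X in _ + X]mulr_natr; field; rewrite nat1r.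
Qed.

Lemma nneg_multiplier_frac {R : realType} {a b : R} :
  0 < a -> a <= b -> nneg_multiplier (fun m => (m%:R + b) / (m%:R + a)).
Proof.
move=> a0 ab.
apply: (@nneg_multiplier_eq _ (fun m => 1 + (b - a) * (m%:R + a)^-1)).
  by move=> m; field; rewrite gt_eqF// ltr_wpDl.
apply: nneg_multiplierD; first exact: nneg_multiplier_const.
apply: nneg_multiplierM; last exact: nneg_multiplierV.
by apply: nneg_multiplier_const; rewrite subr_ge0.
Qed.

(* Matching the smallest [b] with some [a <= b] preserves the domination of the
   counting functions. *)
Lemma nneg_multiplier_prod {R : realType} {sa sb : seq R} :
  all (> 0) sa ->
  (forall x, (count (<= x) sb <= count (<= x) sa)%N) ->
  nneg_multiplier
    (fun m => (\prod_(b <- sb) (m%:R + b)) / \prod_(a <- sa) (m%:R + a)).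
Proof.
move=> sa0 cnt.
apply: (@nneg_multiplier_eq _ (fun m => (\prod_(b <- sort <=%R sb) (m%:R + b)) /
    \prod_(a <- sa) (m%:R + a))).
  by move=> m; congr (_ / _); apply: perm_big; rewrite perm_sort.
have {cnt} : forall x, (count (<= x) (sort <=%R sb) <= count (<= x) sa)%N.
  by move=> x; rewrite count_sort.
have := sort_le_sorted sb; move: (sort <=%R sb) => {}sb.
elim: sb sa sa0 => [|b sb ih] sa sa0 sb_sorted cnt.
  apply: (@nneg_multiplier_eq _ (fun m => \prod_(a <- sa) (m%:R + a)^-1)).
    by move=> m; rewrite big_nil mul1r prodfV.
  elim: sa sa0 {cnt} => [_|a sa ih /= /andP[a0 /ih {}ih]].
    by apply: (@nneg_multiplier_eq _ (fun=> 1)) => [m|];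
      [rewrite big_nil|exact: nneg_multiplier_const].
  apply: (nneg_multiplier_eq _ (nneg_multiplierM (nneg_multiplierV a0) ih)).
  by move=> m; rewrite big_cons.
have : has (<= b) sa.
  by rewrite has_count; apply: leq_trans (cnt b); rewrite /= lexx.
case/hasP => a asa ab.
have psa := perm_to_rem asa.
have a0 : 0 < a by move/allP : sa0; exact.
have ih' : nneg_multiplier (fun m => (\prod_(b <- sb) (m%:R + b)) /
    \prod_(a <- rem a sa) (m%:R + a)).
  apply: ih.
  - by move: sa0; rewrite (perm_all _ psa) /= => /andP[].
  - exact: path_sorted sb_sorted.
  (* For [x >= b] both counts lose one, since [a <= b <= x]. For [x < b] the remaining entries of
     the sorted list all exceed [x]. *)
  - move=> x; have := cnt x.
    rewrite [in leqRHS](seq.permP psa) /=; case: (leP b x) => bx.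
      by rewrite (le_trans ab bx).
    suff -> : count (<= x) sb = 0%N by [].
    apply/eqP; rewrite eqn0Ngt -has_count; apply/hasPn => z zb.
    rewrite -ltNge; apply: lt_le_trans bx _.
    move: sb_sorted; rewrite /= (path_sortedE le_trans) => /andP[/allP h _].
    exact: h.
apply: (nneg_multiplier_eq _ (nneg_multiplierM (nneg_multiplier_frac a0 ab) ih')).
by move=> m; rewrite big_cons (perm_big _ psa) big_cons /= mulf_div.
Qed.

(** For [y >= 0] the count is the minimum of [n] and the integer part of [y]. Positivity of [k]
    excludes negative [y], where the count is 0. *)
Lemma count_iota_le {R : realDomainType} {y : R} {n : nat} :
  let k := count (fun j => j.+1%:R <= y) (iota 0 n) in (0 < k)%N -> k%:R <= y.
Proof.
elim: n => [|n ih] //; rewrite -[in iota _ _]addn1 iotaD count_cat add0n /= addn0.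
case: (leP n.+1%:R y) => ny; last by rewrite addn0.
move=> _; apply: le_trans ny; rewrite ler_nat addn1 ltnS.
by rewrite -[leqRHS](size_iota 0) count_size.
Qed.

Lemma count_iota_ge {R : realDomainType} (y : R) (k n : nat) :
  (k <= n)%N -> k%:R <= y -> (k <= count (fun j => (j.+1%:R <= y)%R) (iota 0 n))%N.
Proof.
move=> kn ky; rewrite -(subnKC kn) iotaD count_cat.
have : all (fun j => j.+1%:R <= y) (iota 0 k).
  apply/allP => j; rewrite mem_iota add0n => /andP[_ jk].
  by apply: le_trans ky; rewrite ler_nat.
rewrite all_count => /eqP ->.
by rewrite size_iota leq_addr.
Qed.

(** * The approximating weights and their multiplier property *)

Definition binom_weight {R : realType} (p r : R) (N M m : nat) : R :=
  (\prod_(k < N) (m%:R + k.+1%:R)) *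
  (\prod_(j < M) (m%:R * (p - 1) + r + j.+1%:R)) /
  \prod_(j < N + M) (m%:R * p + r + j.+1%:R).

(** Brings the factors to the form [m + a] that [nneg_multiplier_prod] expects; the power of [q]
    goes into a constant multiplier. *)
Lemma prod_affine {R : realType} (q r : R) (n m : nat) : 0 < q ->
  \prod_(j < n) (m%:R * q + r + j.+1%:R) =
  q ^+ n * \prod_(a <- [seq (r + j.+1%:R) / q | j <- iota 0 n]) (m%:R + a).
Proof.
move=> q0; elim: n => [|n ih]; first by rewrite big_ord0 big_nil expr0 mul1r.
rewrite big_ord_recr ih -(addn1 n) iotaD add0n map_cat big_cat /=.
by rewrite big_seq1 addn1 exprSr; field; rewrite gt_eqF.
Qed.

Lemma nneg_multiplier_binom_weight {R : realType} {p r : R} (N M : nat) :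
  1 <= p -> -1 < r -> r <= p - 1 -> nneg_multiplier (binom_weight p r N M).
Proof.
move=> p1 r1 rp; have p0 : 0 < p by lra.
pose sa := [seq (r + j.+1%:R) / p | j <- iota 0 (N + M)].
pose sN := [seq k.+1%:R : R | k <- iota 0 N].
have prodN m : \prod_(k < N) (m%:R + k.+1%:R) = \prod_(b <- sN) (m%:R + b).
  rewrite big_map -[in LHS](big_mkord xpredT (fun k => m%:R + k.+1%:R : R)).
  by rewrite /index_iota subn0.
have sa0 : all (> 0) sa.
  apply/allP => _ /mapP[j _ ->]; rewrite divr_gt0// -natr1.
  by have := ler0n R j; lra.
have counta x : count (<= x) sa = count (fun j => j.+1%:R <= x * p - r) (iota 0 (N + M)).
  rewrite count_map; apply: eq_count => j /=.
  by rewrite ler_pdivrMr// lerBrDl.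
have countN x : count (<= x) sN = count (fun j => j.+1%:R <= x) (iota 0 N).
  by rewrite count_map.
have countN_le (x : R) : (count (fun j => (j.+1%:R <= x)%R) (iota 0 N) <= N)%N.
  by rewrite -[leqRHS](size_iota 0) count_size.
(* For [p = 1] the factors of slope [p - 1] do not depend on [m] and join the constant. *)
have [p_eq1|p_neq1] := eqVneq p 1.
  have c0 : 0 <= (\prod_(j < M) (r + j.+1%:R)) / p ^+ (N + M).
    apply: divr_ge0; last by rewrite exprn_ge0// ltW.
    apply: prodr_ge0 => j _; rewrite -natr1.
    by have := ler0n R j; lra.
  have sNa x : (count (<= x)%R sN <= count (<= x)%R sa)%N.
    rewrite counta countN; set k := count _ (iota 0 N).
    have [->//|k0] := posnP k.
    apply: count_iota_ge; first by rewrite (leq_trans (countN_le x)) ?leq_addr.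
    by have := count_iota_le k0; rewrite -/k p_eq1; lra.
  apply: nneg_multiplier_eq (nneg_multiplierM (nneg_multiplier_const c0)
    (nneg_multiplier_prod sa0 sNa)) => m.
  rewrite /binom_weight -prodN (prod_affine _ _ (N + M)) //.
  have -> : \prod_(j < M) (m%:R * (p - 1) + r + j.+1%:R) = \prod_(j < M) (r + j.+1%:R).
    by apply: eq_bigr => j _; rewrite p_eq1 subrr mulr0 add0r.
  by rewrite -/sa invfM; ring.
have q0 : 0 < p - 1 by rewrite subr_gt0 lt_neqAle eq_sym p_neq1.
pose sM := [seq (r + j.+1%:R) / (p - 1) | j <- iota 0 M].
have countM x : count (<= x) sM = count (fun j => j.+1%:R <= x * (p - 1) - r) (iota 0 M).
  rewrite count_map; apply: eq_count => j /=.
  by rewrite ler_pdivrMr// lerBrDl.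
have countM_le (x : R) : (count (fun j => (j.+1%:R <= x)%R) (iota 0 M) <= M)%N.
  by rewrite -[leqRHS](size_iota 0) count_size.
have sba x : (count (<= x)%R (sN ++ sM) <= count (<= x)%R sa)%N.
  rewrite count_cat counta countN countM.
  set k := count _ (iota 0 N); set l := count _ (iota 0 M).
  have klNM : (k + l <= N + M)%N by rewrite leq_add ?countN_le ?countM_le.
  (* The goal is [k + l <= x p - r]. If only [l] is positive, [1 <= l] and [r > -1] force [x > 0];
     if only [k] is, [x >= 1] and [r <= p - 1] give [x (p - 1) >= r]; if both are, their bounds [x]
     and [x (p - 1) - r] add up. *)
  have [k0|k0] := posnP k; have [l0|l0] := posnP l; first by rewrite k0 l0.
  - have := count_iota_le l0; rewrite -/l => lx.
    apply: count_iota_ge => //; rewrite k0 add0n.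
    have : 1 <= l%:R :> R by rewrite ler1n.
    by nra.
  - have := count_iota_le k0; rewrite -/k => kx.
    apply: count_iota_ge => //; rewrite l0 addn0.
    have : 1 <= k%:R :> R by rewrite ler1n.
    by nra.
  - have := count_iota_le l0; rewrite -/l => lx.
    have := count_iota_le k0; rewrite -/k => kx.
    by apply: count_iota_ge => //; rewrite natrD; nra.
have c0 : 0 <= (p - 1) ^+ M / p ^+ (N + M).
  by rewrite divr_ge0 ?exprn_ge0// ltW.
apply: nneg_multiplier_eq (nneg_multiplierM (nneg_multiplier_const c0)
  (nneg_multiplier_prod sa0 sba)) => m.
rewrite /binom_weight prodN !prod_affine// -/sa -/sM big_cat/= invfM; ring.
Qed.

(** * Rising factorials and the limit of the weights *)

(** The Pochhammer symbol, equal to [Gamma (x + n) / Gamma x] for positive [x]. *)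
Definition rising {R : nzRingType} (x : R) (n : nat) : R :=
  \prod_(j < n) (x + j%:R).

Lemma rising_gt0 {R : numDomainType} (x : R) (n : nat) : 0 < x -> 0 < rising x n.
Proof. by move=> x0; apply: prodr_gt0 => j _; rewrite ltr_wpDr. Qed.

Lemma risingD {R : nzRingType} (x : R) (m n : nat) :
  rising x (m + n) = rising x m * rising (x + m%:R) n.
Proof.
rewrite /rising big_split_ord; congr (_ * _).
by apply: eq_bigr => j _; rewrite natrD addrA.
Qed.

Lemma rising1 {R : nzRingType} (n : nat) : rising (1 : R) n = n`!%:R.
Proof.
elim: n => [|n ih]; first by rewrite /rising big_ord0 fact0.
by rewrite -addn1 risingD ih /rising big_ord1 addr0 addn1 factS mulnC natrM nat1r.
Qed.

Lemma gbinom_rising {R : realType} (x : R) (m : nat) :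
  gbinom (x + m%:R) m = rising (x + 1) m / m`!%:R.
Proof.
rewrite /gbinom /rising; congr (_ / _).
rewrite (reindex_inj rev_ord_inj); apply: eq_bigr => i _ /=.
by rewrite natrB// -natr1; ring.
Qed.

(** Isolates the binomial coefficient, which does not depend on [N] and [M], from factors whose
    asymptotics are computable. *)
Lemma binom_weightE {R : realType} (p r : R) (N M m : nat) :
  1 <= p -> -1 < r ->
  binom_weight p r N M m = gbinom (m%:R * p + r) m * N`!%:R *
    rising (N.+1%:R) m / rising (r + 1 + M%:R + m%:R * (p - 1)) (N + m).
Proof.
move=> p1 r1; set s := m%:R * (p - 1).
have s0 : 0 <= s by rewrite mulr_ge0// subr_ge0.
have z0 : 0 < s + r + 1 by lra.
have -> : m%:R * p + r = s + r + m%:R by rewrite /s; ring.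
rewrite gbinom_rising /binom_weight.
have -> : \prod_(k < N) (m%:R + k.+1%:R) = rising m.+1%:R N :> R.
  by apply: eq_bigr => k _; rewrite -!natr1; ring.
have -> : \prod_(j < M) (m%:R * (p - 1) + r + j.+1%:R) = rising (s + r + 1) M.
  by apply: eq_bigr => j _; rewrite -natr1 /s; ring.
have -> : \prod_(j < N + M) (m%:R * p + r + j.+1%:R) =
    rising (s + r + 1 + m%:R) (N + M).
  by apply: eq_bigr => j _; rewrite -natr1 /s; ring.
(* The rising factorial of length [m + N + M] at [s + r + 1] is split in two ways, after [m] and
   after [M] factors. In [E2] the same is done for [(m + N)!]. *)
have E1 := risingD (s + r + 1) m (N + M).
have := risingD (s + r + 1) M (N + m).
rewrite (_ : M + (N + m) = m + (N + M))%N; last by lia.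
rewrite E1 => {}E1.
have E2 : m`!%:R * rising m.+1%:R N = N`!%:R * rising N.+1%:R m :> R.
  by rewrite -!rising1 -!nat1r -!risingD addnC.
have -> : r + 1 + M%:R + s = s + r + 1 + M%:R by ring.
have h1 : rising (s + r + 1 + m%:R) (N + M) != 0.
  by rewrite gt_eqF// rising_gt0// ltr_wpDr.
have h2 : rising (s + r + 1 + M%:R) (N + m) != 0.
  by rewrite gt_eqF// rising_gt0// ltr_wpDr.
have h3 : m`!%:R != 0 :> R by rewrite pnatr_eq0 -lt0n fact_gt0.
apply: (mulIf h1); rewrite divfK//; apply: (mulIf h2); apply: (mulIf h3).
transitivity ((m`!%:R * rising m.+1%:R N) *
  (rising (s + r + 1) M * rising (s + r + 1 + M%:R) (N + m))); first by ring.
by rewrite E2 -E1; field; rewrite h2.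
Qed.

(** * Logarithmic estimates and limits of quotients of rising factorials *)

Lemma ln1D_ge {R : realType} {x : R} : 0 <= x -> x / (1 + x) <= ln (1 + x).
Proof.
move=> x0; rewrite -lerN2 -lnV ?posrE; last by lra.
rewrite [X in ln X](_ : _ = 1 + (- (x / (1 + x)))); last by field; lra.
by apply: le_ln1Dx; rewrite ltrN2 ltr_pdivrMr; lra.
Qed.

Lemma ln1D_le {R : realType} {x : R} : 0 <= x -> ln (1 + x) <= x.
Proof. by move=> x0; apply: le_ln1Dx; lra. Qed.

(** Both terms are at most [s / t]; the first falls short of it by at most [s ^ 2 / t ^ 2], the
    second by at most [s / t ^ 2]. *)
Lemma ln_shift_approx {R : realType} {s t : R} : 0 <= s -> 0 < t ->
  `|ln (1 + s / t) - s * (ln (t + 1) - ln t)| <= (s ^+ 2 + s) / t ^+ 2.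
Proof.
move=> s0 t0.
have -> : ln (t + 1) - ln t = ln (1 + t^-1).
  rewrite -ln_div ?posrE//; last by lra.
  by rewrite mulrDl divff ?mul1r// gt_eqF.
have st0 : 0 <= s / t by rewrite divr_ge0// ltW.
have t'0 : 0 <= t^-1 by rewrite invr_ge0 ltW.
have := ln1D_ge st0; have := ln1D_le st0.
have := ln1D_ge t'0; have := ln1D_le t'0.
move: (ln _) (ln _) => u v h1 h2 h3 h4.
have e1 : s / t / (1 + s / t) >= s / t - s ^+ 2 / t ^+ 2.
  rewrite -subr_ge0 (_ : _ - _ = s ^+ 3 / (t ^+ 2 * (t + s))); last by field; lra.
  by rewrite divr_ge0 ?exprn_ge0// mulr_ge0 ?exprn_ge0//; lra.
have e2 : t^-1 / (1 + t^-1) >= t^-1 - 1 / t ^+ 2.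
  rewrite -subr_ge0 (_ : _ - _ = 1 / (t ^+ 2 * (t + 1))); last by field; lra.
  by rewrite divr_ge0// mulr_ge0 ?exprn_ge0//; lra.
have k1 := ler_wpM2l s0 h1.
have k2 := ler_wpM2l s0 (le_trans e2 h2).
have E : s / t = s * t^-1 by [].
have k3 : 0 <= s ^+ 2 / t ^+ 2 by rewrite divr_ge0// exprn_ge0// ltW.
have k4 : 0 <= s / t ^+ 2 by rewrite divr_ge0// exprn_ge0// ltW.
rewrite mulrDl ler_norml; apply/andP; split.
  by move: k1; lra.
by move: k2; rewrite mulrBr mulrA mulr1; lra.
Qed.

(** Sums [ln_shift_approx] over [t = y + j] for [j < N]: the logarithms of [(t + 1) / t] telescope,
    and each error is at most the one at [t = y]. *)
Lemma ln_rising_approx {R : realType} {s y : R} (N : nat) : 0 <= s -> 0 < y ->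
  `|ln (rising (y + s) N / rising y N) - s * ln ((y + N%:R) / y)| <=
  N%:R * ((s ^+ 2 + s) / y ^+ 2).
Proof.
move=> s0 y0; elim: N => [|N ih].
  by rewrite /rising !big_ord0 addr0 !divff ?gt_eqF// ln1 mulr0 subrr normr0 mul0r.
have yN : 0 < y + N%:R by rewrite ltr_wpDr.
have yN1 : 0 < y + N.+1%:R by rewrite ltr_wpDr.
have ysN : 0 < y + s + N%:R by rewrite ltr_wpDr// ltr_wpDr.
have ys : 0 < y + s by rewrite ltr_wpDr.
have -> : rising (y + s) N.+1 / rising y N.+1 =
    (rising (y + s) N / rising y N) * (1 + s / (y + N%:R)).
  rewrite -addn1 !risingD /rising !big_ord1 !addr0 -/(rising _ _) -/(rising _ _).
  by field; rewrite !gt_eqF ?rising_gt0.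
have q1 : 0 < rising (y + s) N / rising y N by rewrite divr_gt0 ?rising_gt0.
have q2 : 0 < 1 + s / (y + N%:R) by rewrite ltr_wpDr// divr_ge0// ltW.
rewrite [X in `|X - _|]lnM ?posrE//.
have -> : ln ((y + N.+1%:R) / y) =
    ln ((y + N%:R) / y) + (ln (y + N%:R + 1) - ln (y + N%:R)).
  rewrite !ln_div ?posrE// -natr1 addrA; ring.
rewrite mulrDr opprD addrACA; apply: le_trans (ler_normD _ _) _.
rewrite -[N.+1%:R]natr1 [leRHS]mulrDl mul1r lerD//.
apply: le_trans (ln_shift_approx s0 yN) _.
rewrite ler_wpM2l ?addr_ge0 ?exprn_ge0// lef_pV2 ?posrE ?exprn_gt0//.
by rewrite lerXn2r ?nnegrE ?(ltW yN) ?(ltW y0)// lerDl.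
Qed.

Lemma cvg_seq_eq {R : realType} {f g : R^nat} {l l' : R} :
  f =1 g -> l = l' -> f @ \oo --> l -> g @ \oo --> l'.
Proof. by move=> /funext -> ->. Qed.

Lemma cvg_rising_quot {R : realType} {y : R^nat} {q s : R} (m : nat) :
  (forall n, 0 < y n) -> 0 <= q -> 0 <= s ->
  y n / n.+1%:R @[n --> \oo] --> q ->
  rising n.+2%:R m / rising (y n + s + n.+1%:R) m @[n --> \oo] -->
    (q + 1)^-1 ^+ m.
Proof.
move=> y0 q0 s0 yq; elim: m => [|m ih].
  under eq_cvg do rewrite /rising !big_ord0 divr1.
  by rewrite expr0; exact: cvg_cst.
have h0 : @harmonic R n @[n --> \oo] --> 0 := cvg_harmonic.
(* Numerator and denominator of the new factor are both divided by [n.+1], whose inverse is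
   [harmonic n]. *)
have num : 1 + (1 + m%:R) * @harmonic R n @[n --> \oo] --> (1 : R).
  rewrite -[X in _ --> X]addr0; apply: cvgD; first exact: cvg_cst.
  by rewrite -[X in _ --> X](mulr0 (1 + m%:R)); exact: (cvgMl_tmp h0).
have den : y n / n.+1%:R + 1 + (s + m%:R) * @harmonic R n @[n --> \oo] --> q + 1.
  rewrite -[X in _ --> X]addr0; apply: cvgD.
    by apply: cvgD => //; exact: cvg_cst.
  by rewrite -[X in _ --> X](mulr0 (s + m%:R)); exact: (cvgMl_tmp h0).
have q1 : q + 1 != 0 by rewrite gt_eqF// ltr_wpDl.
rewrite exprSr; apply: cvg_seq_eq (cvgM ih (cvgM num (cvgV q1 den))) => [n|] /=;
  last by rewrite mul1r.
rewrite -[m.+1]addn1 !risingD /rising !big_ord1 !addr0 -/(rising _ _) -/(rising _ _).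
rewrite [in RHS]invfM [RHS]mulrACA; congr (_ * _).
have := y0 n; move: (y n) => z z0.
have m0 := ler0n R m; have n0 := ltr0Sn R n.
rewrite /harmonic -[n.+2%:R]natr1; move: (n.+1%:R) n0 => N N0.
have h1 : z + s + N + m%:R != 0 by rewrite gt_eqF//; lra.
rewrite (_ : z / N + 1 + (s + m%:R) * N^-1 = (z + s + N + m%:R) / N); last first.
  by field; lra.
by field; rewrite h1 gt_eqF.
Unshelve. all: by end_near. Qed.

(** The limit is the real power [(q / (q + 1)) ^ s]. *)
Lemma cvg_rising_ratio {R : realType} {y : R^nat} {q s : R} :
  (forall n, 0 < y n) -> 0 < q -> 0 <= s ->
  y n / n.+1%:R @[n --> \oo] --> q ->
  rising (y n) n.+1 / rising (y n + s) n.+1 @[n --> \oo] -->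
    expR (- (s * ln ((q + 1) / q))).
Proof.
move=> y0 q0 s0 yq.
have h0 : @harmonic R n @[n --> \oo] --> 0 := cvg_harmonic.
have q_neq0 : q != 0 by rewrite gt_eqF.
have yn1 : (y n + n.+1%:R) / y n @[n --> \oo] --> (q + 1) / q.
  apply: cvg_seq_eq (cvgD (cvg_cst (1 : R)) (cvgV q_neq0 yq)) => [n|] /=.
    by rewrite fctE /unstable.inv_fun /cst /= invf_div mulrDl divff// gt_eqF.
  by rewrite mulrDl divff// mul1r.
have lnyn : s * ln ((y n + n.+1%:R) / y n) @[n --> \oo] --> s * ln ((q + 1) / q).
  apply: cvgMl_tmp; apply: continuous_cvg yn1.
  by apply: continuous_ln; rewrite divr_gt0//; lra.
(* As [y n] grows like [q n], the accumulated error is of order [1 / n]. *)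
have bound : n.+1%:R * ((s ^+ 2 + s) / y n ^+ 2) @[n --> \oo] --> (0 : R).
  apply: cvg_seq_eq (cvgM (cvgM (cvg_cst (s ^+ 2 + s)) h0)
    (cvgM (cvgV q_neq0 yq) (cvgV q_neq0 yq))) => [n|] /=.
    have := y0 n; have := ltr0Sn R n; move: (y n) (n.+1%:R) => z N N0 z0.
    by rewrite /cst /harmonic /=; field; rewrite !gt_eqF.
  by rewrite mulr0 mul0r.
have diff : ln (rising (y n + s) n.+1 / rising (y n) n.+1) -
    s * ln ((y n + n.+1%:R) / y n) @[n --> \oo] --> (0 : R).
  apply/cvgr0Pnorm_le => e e0; near=> n.
  apply: le_trans (ln_rising_approx n.+1 s0 (y0 n)) _.
  by near: n; move/cvgr0_norm_le: bound => /(_ _ e0); apply: filterS => n;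
    apply: le_trans; exact: ler_norm.
have lnr : ln (rising (y n + s) n.+1 / rising (y n) n.+1) @[n --> \oo] -->
    s * ln ((q + 1) / q).
  apply: cvg_seq_eq (cvgD diff lnyn) => [n|] /=; last by rewrite add0r.
  by rewrite fctE subrK.
apply: cvg_seq_eq (continuous_cvg _ (@continuous_expR R _) (cvgN lnr)) => // n /=.
by rewrite expRN lnK ?invf_div// posrE divr_gt0 ?rising_gt0// ltr_wpDr.
Unshelve. all: by end_near. Qed.

Lemma c_edge1 {R : realType} : c_edge (1 : R) = 1.
Proof. by rewrite /c_edge subrr powRr0 powRr1// divr1. Qed.

Lemma c_edge_expR {R : realType} (p : R) : 1 < p ->
  c_edge p = expR (p * ln p - (p - 1) * ln (p - 1)).
Proof.
move=> p1; rewrite /c_edge /powR !gt_eqF; [|lra..].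
by rewrite -expRN -expRD.
Qed.

Lemma c_edge_gt0 {R : realType} (p : R) : 1 <= p -> 0 < c_edge p.
Proof.
rewrite le_eqVlt => /predU1P[<-|p1]; first by rewrite c_edge1.
by rewrite c_edge_expR// expR_gt0.
Qed.

(** Here [N = n.+1], and [M n] is the integer part of [(p - 1) N], so that [M / N] tends to [p - 1].
    Dividing by the value at [m = 0] cancels [N!]. *)
Lemma cvg_binom_weight {R : realType} (p r : R) (m : nat) :
  1 <= p -> -1 < r ->
  let M n := Num.truncn ((p - 1) * n.+1%:R) in
  binom_weight p r n.+1 (M n) m / binom_weight p r n.+1 (M n) 0
    @[n --> \oo] --> gbinom (m%:R * p + r) m / c_edge p ^+ m.
Proof.
move=> p1 r1 M; pose y n := r + 1 + (M n)%:R.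
have y0 n : 0 < y n by rewrite ltr_wpDr//; lra.
have q0 : 0 <= p - 1 by lra.
pose s := m%:R * (p - 1).
have s0 : 0 <= s by rewrite mulr_ge0.
have h0 : @harmonic R n @[n --> \oo] --> 0 := cvg_harmonic.
(* [M n] is within 1 of [(p - 1) * n.+1], whence the two bounds. *)
have yq : y n / n.+1%:R @[n --> \oo] --> p - 1.
  apply: (@squeeze_cvgr _ _ _ _ (fun n => (p - 1) + r * harmonic n)
    (fun n => (p - 1) + (r + 1) * harmonic n)).
  - near=> n; rewrite /harmonic /y /M.
    have n0 := ltr0Sn R n.
    have /truncn_itv : 0 <= (p - 1) * n.+1%:R by rewrite mulr_ge0.
    rewrite /= -[(Num.truncn _).+1%:R]natr1; move: (_%:R) => A /andP[].
    move: (n.+1%:R) n0 => /= B B0 h1 h2.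
    by rewrite ler_pdivlMr// ler_pdivrMr// !mulrDl !divfK ?gt_eqF//; lra.
  - rewrite -[X in _ --> X]addr0; apply: cvgD; first exact: cvg_cst.
    by rewrite -[X in _ --> X](mulr0 r); exact: (cvgMl_tmp h0).
  - rewrite -[X in _ --> X]addr0; apply: cvgD; first exact: cvg_cst.
    by rewrite -[X in _ --> X](mulr0 (r + 1)); exact: (cvgMl_tmp h0).
have l1 := cvg_rising_quot m y0 q0 s0 yq.
(* For [p > 1] the limit is [((p - 1) / p) ^ (m (p - 1))], which is [p ^ m / c ^ m]; the factor
   [p ^ m] cancels against [l1]. For [p = 1] the shift [s] is 0. *)
have l2 : rising (y n) n.+1 / rising (y n + s) n.+1 @[n --> \oo] -->
    (c_edge p ^+ m)^-1 * p ^+ m.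
  move: p1; rewrite le_eqVlt => /predU1P[p1|p1].
    have -> : s = 0 by rewrite /s -p1 subrr mulr0.
    rewrite -p1 c_edge1 !expr1n invr1 mulr1.
    apply: cvg_seq_eq (cvg_cst (1 : R)) => // n /=.
    by rewrite /cst addr0 divff// gt_eqF// rising_gt0.
  have q0' : 0 < p - 1 by lra.
  apply: cvg_seq_eq (cvg_rising_ratio y0 q0' s0 yq) => //.
  rewrite subrK.
  have p0 : 0 < p by lra.
  rewrite c_edge_expR// -[in p ^+ m](lnK p0) -!expRM_natl -expRN -expRD.
  by congr expR; rewrite ln_div// /s; ring.
apply: cvg_seq_eq (cvgM (cvg_cst (gbinom (m%:R * p + r) m)) (cvgM l1 l2)) => [n|] /=;
  last first.
  have p0 : 0 < p by lra.
  by rewrite subrK exprVn; field; rewrite !expf_neq0// gt_eqF// c_edge_gt0.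
(* The weight at 0 is [N! / rising (y n) N]; the denominator at [m] is split after its first [N]
   factors. *)
rewrite /cst /= !binom_weightE// !(mulr0n, mul0r) addr0 -/(y n) -/s addn0.
rewrite [rising _ 0]big_ord0 risingD /gbinom big_ord0 fact0 divr1.
have N0 : n.+1`!%:R != 0 :> R by rewrite pnatr_eq0 -lt0n fact_gt0.
have ys0 : 0 < y n + s by rewrite ltr_wpDr.
have ysn0 : 0 < y n + s + n.+1%:R by rewrite ltr_wpDr.
rewrite !mul1r !mulr1 !invfM invrK.
have h1 := lt0r_neq0 (rising_gt0 (y n) n.+1 (y0 n)).
have h2 := lt0r_neq0 (rising_gt0 (y n + s) n.+1 ys0).
have h3 := lt0r_neq0 (rising_gt0 (y n + s + n.+1%:R) m ysn0).
by field; rewrite h2 h3 N0 pnatr_eq0 -lt0n fact_gt0.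
Unshelve. all: by end_near. Qed.

(** * Positivity of the moment form *)

(* The linear form on polynomials sending 'X^m to s m. *)
Definition moment_form {R : nzRingType} (s : nat -> R) (P : {poly R}) : R :=
  (hadamard s P).[1].

Lemma moment_formE {R : nzRingType} (s : nat -> R) (P : {poly R}) :
  moment_form s P = \sum_(i < size P) s i * P`_i.
Proof.
by rewrite /moment_form horner_poly; apply: eq_bigr => i _; rewrite expr1n mulr1.
Qed.

Lemma moment_formD {R : nzRingType} (s : nat -> R) (P Q : {poly R}) :
  moment_form s (P + Q) = moment_form s P + moment_form s Q.
Proof.
rewrite /moment_form -hornerD; congr (_.[1]).
by apply/polyP => i; rewrite coefD !coef_hadamard coefD mulrDr.
Qed.

Lemma moment_formZ {R : comNzRingType} (s : nat -> R) (c : R) (P : {poly R}) :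
  moment_form s (c *: P) = c * moment_form s P.
Proof.
rewrite /moment_form -hornerZ; congr (_.[1]).
by apply/polyP => i; rewrite coefZ !coef_hadamard coefZ mulrCA.
Qed.

Lemma moment_formB {R : comNzRingType} (s : nat -> R) (P Q : {poly R}) :
  moment_form s (P - Q) = moment_form s P - moment_form s Q.
Proof. by rewrite -[- Q]scaleN1r moment_formD moment_formZ mulN1r. Qed.

Lemma moment_formC {R : comNzRingType} (s : nat -> R) (c : R) :
  moment_form s c%:P = c * s 0%N.
Proof.
have [->|c0] := eqVneq c 0; first by rewrite moment_formE size_poly0 big_ord0 mul0r.
by rewrite moment_formE size_polyC c0 big_ord1 coefC mulrC.
Qed.

Lemma moment_formXn {R : nzRingType} (s : nat -> R) (m : nat) :
  moment_form s 'X^m = s m.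
Proof.
rewrite moment_formE size_polyXn big_ord_recr /= coefXn eqxx mulr1 big1 ?add0r//.
by move=> i _; rewrite coefXn ltn_eqF ?mulr0.
Qed.

Lemma moment_form_sum {R : comNzRingType} (s : nat -> R) I (l : seq I)
    (F : I -> {poly R}) :
  moment_form s (\sum_(i <- l) F i) = \sum_(i <- l) moment_form s (F i).
Proof.
apply: (big_morph (moment_form s)); first exact: moment_formD.
by rewrite -[0]/(0%:P) moment_formC mul0r.
Qed.

Lemma cvg_moment_form {R : realType} {s : nat -> R^nat} {t : R^nat} (P : {poly R}) :
  (forall i, s n i @[n --> \oo] --> t i) ->
  moment_form (s n) P @[n --> \oo] --> moment_form t P.
Proof.
move=> st; rewrite moment_formE; under eq_cvg do rewrite moment_formE.
apply: (cvg_big (@add_continuous _)) => i _.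
by apply: cvgMr_tmp; exact: st.
Qed.

Lemma binom_weight0_gt0 {R : realType} (p r : R) (N M : nat) :
  1 <= p -> -1 < r -> 0 < binom_weight p r N M 0.
Proof.
move=> p1 r1; rewrite /binom_weight divr_gt0//; last first.
  apply: prodr_gt0 => j _; rewrite mul0r add0r -natr1.
  by have := ler0n R j; lra.
rewrite mulr_gt0//; first by apply: prodr_gt0 => j _; rewrite add0r.
apply: prodr_gt0 => j _; rewrite mul0r add0r -natr1.
by have := ler0n R j; lra.
Qed.

Lemma horner_hadamard_exp {R : comNzRingType} (c x : R) (P : {poly R}) :
  (hadamard (fun i => c ^+ i) P).[x] = P.[c * x].
Proof.
rewrite horner_poly [RHS]horner_coef; apply: eq_bigr => i _.
by rewrite exprMn; ring.
Qed.

Lemma moment_form_gbinom_ge0_gtN1 {R : realType} (p r : R) (P : {poly R}) :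
  1 <= p -> -1 < r -> r <= p - 1 -> nneg_on (c_edge p) P ->
  0 <= moment_form (fun m => gbinom (m%:R * p + r) m) P.
Proof.
move=> p1 r1 rp hP; pose c := c_edge p; have c0 : 0 < c by exact: c_edge_gt0.
pose M n := Num.truncn ((p - 1) * n.+1%:R).
pose w n m := binom_weight p r n.+1 (M n) m.
have hw n : 0 <= moment_form (fun m => w n m / w n 0 * c ^+ m) P.
  (* The powers of [c] turn [P] into [P.[c * x]], which is nonnegative on the unit interval; the
     multiplier [w n] is then applied and the result evaluated at 1. *)
  have -> : moment_form (fun m => w n m / w n 0 * c ^+ m) P =
      (hadamard (w n) (hadamard (fun i => c ^+ i) P)).[1] / w n 0.
    rewrite mulrC -moment_formZ /moment_form; congr (_.[1]).
    by apply/polyP => i; rewrite !(coef_hadamard, coefZ); ring.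
  rewrite divr_ge0 ?(ltW (binom_weight0_gt0 _ _ _ _ _ _))//.
  apply: nneg_multiplier_binom_weight => //; last by rewrite ler01 lexx.
  move=> x /andP[x0 x1]; rewrite horner_hadamard_exp; apply: hP.
  by rewrite mulr_ge0 ?(ltW c0)//= ger_pMr.
suff l : moment_form (fun m => w n m / w n 0 * c ^+ m) P @[n --> \oo] -->
    moment_form (fun m => gbinom (m%:R * p + r) m) P.
  by apply: (cvgr_to_ge l); near=> n; exact: hw.
apply: cvg_moment_form => i.
apply: cvg_seq_eq (cvgMr_tmp (cvg_binom_weight p r i p1 r1)) => //.
by rewrite divfK// expf_neq0// gt_eqF.
Unshelve. all: by end_near. Qed.

Lemma cvg_gbinom {R : realType} (u : R^nat) (a : R) (m : nat) :
  u n @[n --> \oo] --> a -> gbinom (u n) m @[n --> \oo] --> gbinom a m.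
Proof.
move=> ua; apply: cvgMr_tmp; apply: (cvg_big (@mul_continuous _)) => i _.
by apply: cvgB => //; exact: cvg_cst.
Qed.

Lemma moment_form_gbinom_ge0 {R : realType} (p r : R) (P : {poly R}) :
  1 <= p -> -1 <= r -> r <= p - 1 -> nneg_on (c_edge p) P ->
  0 <= moment_form (fun m => gbinom (m%:R * p + r) m) P.
Proof.
move=> p1; rewrite le_eqVlt => /predU1P[<- rp hP|]; last first.
  exact: moment_form_gbinom_ge0_gtN1.
(* These values exceed -1 and are at most 0, hence at most [p - 1]. *)
pose u n : R := -1 + harmonic n.
have u1 : u n @[n --> \oo] --> (-1 : R).
  apply: cvg_seq_eq (cvgD (cvg_cst (-1 : R)) cvg_harmonic) => //.
  by rewrite addr0.
have hu n : 0 <= moment_form (fun m => gbinom (m%:R * p + u n) m) P.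
  have h1 : harmonic n <= 1 :> R by rewrite invf_le1// ler1n.
  have h0 : 0 < harmonic n :> R by rewrite invr_gt0.
  by apply: moment_form_gbinom_ge0_gtN1 => //; rewrite /u; lra.
suff l : moment_form (fun m => gbinom (m%:R * p + u n) m) P @[n --> \oo] -->
    moment_form (fun m => gbinom (m%:R * p - 1) m) P.
  by apply: (cvgr_to_ge l); near=> n; exact: hu.
apply: cvg_moment_form => i; apply: cvg_gbinom.
by apply: cvgD => //; exact: cvg_cst.
Unshelve. all: by end_near. Qed.

(** * The distribution function of a positive moment form *)

Lemma bernoulli_ineq {R : realDomainType} (x : R) (n : nat) :
  -1 <= x -> 1 + n%:R * x <= (1 + x) ^+ n.
Proof.
move=> x1; elim: n => [|n ih]; first by rewrite mul0r addr0 expr0.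
have x0 : 0 <= 1 + x by lra.
rewrite exprS; apply: le_trans (ler_wpM2l x0 ih).
rewrite -natr1 -subr_ge0 (_ : _ - _ = n%:R * x ^+ 2); last by ring.
by rewrite mulr_ge0// sqr_ge0.
Qed.

Lemma expr_small {R : realType} (x e : R) : 0 <= x < 1 -> 0 < e ->
  \forall n \near \oo, x ^+ n <= e.
Proof.
move=> /andP[x0 x1] e0.
have : (fun n => x ^+ n) @ \oo --> (0 : R) by apply: cvg_expr; rewrite ger0_norm.
move/cvgr0_norm_le => /(_ _ e0); apply: filterS => n; apply: le_trans.
exact: ler_norm.
Qed.

(* Stone's polynomials (1 - u ^ n) ^ K with K close to rho ^ (- n), where
   a < rho < b, approach 1 on [0, a] and 0 on [b, 1]. *)
Lemma exists_sharp_poly1 {R : realType} {a b e : R} :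
  0 <= a -> a < b -> b <= 1 -> 0 < e ->
  exists n K : nat, forall u, 0 <= u <= 1 ->
    [/\ 0 <= (1 - u ^+ n) ^+ K <= 1,
        u <= a -> 1 - e <= (1 - u ^+ n) ^+ K &
        b <= u -> (1 - u ^+ n) ^+ K <= e].
Proof.
move=> a0 ab b1 e0; pose rho := (a + b) / 2.
have rho0 : 0 < rho by rewrite /rho; lra.
have arho : a < rho by rewrite /rho; lra.
have rhob : rho < b by rewrite /rho; lra.
have b0 : 0 < b by lra.
have h1 : 0 <= a / rho < 1 by rewrite divr_ge0 ?(ltW rho0)//= ltr_pdivrMr// mul1r.
have h2 : 0 <= rho / b < 1 by rewrite divr_ge0 ?(ltW rho0) ?(ltW b0)//= ltr_pdivrMr// mul1r.
have e20 : 0 < e / 2 by rewrite divr_gt0.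
near \oo => n.
have an : (a / rho) ^+ n <= e / 2 by near: n; exact: expr_small.
have bn : (rho / b) ^+ n <= e by near: n; exact: expr_small.
have rn0 : 0 < rho ^+ n by rewrite exprn_gt0.
have rn1 : 1 <= (rho ^+ n)^-1.
  by rewrite invf_ge1// exprn_ile1//; lra.
(* Since [rho ^ (- n) >= 1], the exponent [K.+1] lies between [rho ^ (- n)] and [2 rho ^ (- n)]. *)
have : 0 <= (rho ^+ n)^-1 by lra.
move=> /truncn_itv; set K := (Num.truncn _); rewrite -natr1 => /andP[K1 K2].
exists n, K.+1 => u /andP[u0 u1].
have un0 : 0 <= u ^+ n by rewrite exprn_ge0.
have un1 : u ^+ n <= 1 by rewrite exprn_ile1.
split.
- by rewrite exprn_ge0 ?exprn_ile1//; lra.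
- move=> ua.
  (* Bernoulli bounds the power below by [1 - K.+1 a ^ n], hence by [1 - 2 (a / rho) ^ n]. *)
  have := @bernoulli_ineq _ (- u ^+ n) K.+1; rewrite lerN2 => /(_ un1).
  apply: le_trans; rewrite mulrN lerD2l lerN2 -natr1.
  have una : u ^+ n <= a ^+ n by rewrite lerXn2r ?nnegrE.
  apply: (@le_trans _ _ ((2 * (rho ^+ n)^-1) * a ^+ n)).
    by rewrite ler_pM//; lra.
  by move: an; rewrite expr_div_n; lra.
- move=> bu.
  have bun : b ^+ n <= u ^+ n by rewrite lerXn2r ?nnegrE// ltW.
  have bn0 : 0 < b ^+ n by rewrite exprn_gt0.
  (* An upper bound comes from the conjugate factor: by Bernoulli [(1 + u ^ n) ^ K.+1] is at least
     [K.+1 u ^ n], hence at least [(b / rho) ^ n]. *)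
  have k1 : (1 - u ^+ n) ^+ K.+1 * (1 + u ^+ n) ^+ K.+1 <= 1.
    rewrite -exprMn exprn_ile1//; first by rewrite mulr_ge0//; lra.
    rewrite (_ : _ * _ = 1 - (u ^+ n) ^+ 2); last by ring.
    by rewrite gerBl sqr_ge0.
  have := @bernoulli_ineq _ (u ^+ n) K.+1; rewrite (le_trans _ un0) ?lerN10// => /(_ isT) k2.
  have w0 : 0 <= (1 - u ^+ n) ^+ K.+1 by rewrite exprn_ge0//; lra.
  have k3 : (1 - u ^+ n) ^+ K.+1 * ((rho ^+ n)^-1 * b ^+ n) <= 1.
    apply: le_trans k1; rewrite ler_wpM2l//; apply: le_trans k2.
    apply: (@le_trans _ _ (K.+1%:R * u ^+ n)); last by lra.
    by rewrite -natr1 ler_pM//; [lra|exact: ltW|exact: ltW].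
  apply: le_trans bn; rewrite expr_div_n.
  rewrite -[leRHS]mul1r -ler_pdivrMr ?divr_gt0// invf_div.
  by apply: le_trans k3; rewrite [X in _ * X]mulrC.
Unshelve. all: by end_near. Qed.

Lemma exists_sharp_poly {R : realType} {c a b e : R} :
  0 < c -> a < b -> 0 < e ->
  exists Q : {poly R}, forall t, 0 <= t <= c ->
    [/\ 0 <= Q.[t] <= 1, t <= a -> 1 - e <= Q.[t] & b <= t -> Q.[t] <= e].
Proof.
move=> c0 ab e0.
(* When [a < 0] or [c < b], one of the two conditions on [t] is void and a constant polynomial
   does. *)
have [a0|a0] := ltP a 0.
  exists 0 => t /andP[t0 tc]; rewrite horner0 lexx ler01; split=> // [ta|_]; last exact: ltW.
  by have := le_lt_trans (le_trans t0 ta) a0; rewrite ltxx.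
have [bc|bc] := ltP c b.
  exists 1 => t /andP[t0 tc]; rewrite hornerC lexx ler01; split=> //; first by move=> _; lra.
  by move=> /(lt_le_trans bc); rewrite ltNge tc.
have h1 : 0 <= a / c by rewrite divr_ge0// ltW.
have h2 : a / c < b / c by rewrite ltr_pM2r// invr_gt0.
have h3 : b / c <= 1 by rewrite ler_pdivrMr// mul1r.
have [n [K nK]] := exists_sharp_poly1 h1 h2 h3 e0.
exists ((1 - (c^-1 *: 'X) ^+ n) ^+ K) => t /andP[t0 tc].
have /nK : 0 <= t / c <= 1 by rewrite divr_ge0 ?(ltW c0)//= ler_pdivrMr// mul1r.
rewrite !hornerE [c^-1 * t]mulrC => -[k1 k2 k3]; split=> // ht.
  by apply: k2; rewrite ler_pM2r// invr_gt0.
by apply: k3; rewrite ler_pM2r// invr_gt0.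
Qed.

Definition positive_moments {R : numDomainType} (c : R) (s : nat -> R) :=
  s 0%N = 1 /\ forall P, nneg_on c P -> 0 <= moment_form s P.

Definition step_majorant {R : numDomainType} (c x : R) (P : {poly R}) :=
  forall t, 0 <= t <= c -> (t <= x)%R%:R <= P.[t].

(* The distribution function, at x, of any probability on [0, c] with moments s. *)
Definition poly_cdf {R : realType} (c : R) (s : nat -> R) (x : R) : R :=
  inf [set moment_form s P | P in step_majorant c x].

Section poly_cdf.
Context {R : realType} {c : R} {s : nat -> R}.
Hypotheses (c_gt0 : 0 < c) (s_pos : positive_moments c s).

Lemma moment_form1 (e : R) : moment_form s e%:P = e.
Proof. by rewrite moment_formC s_pos.1 mulr1. Qed.

Lemma ler_moment_form (P Q : {poly R}) :
  (forall t, 0 <= t <= c -> P.[t] <= Q.[t]) -> moment_form s P <= moment_form s Q.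
Proof.
move=> PQ; rewrite -subr_ge0 -moment_formB; apply: s_pos.2 => t /PQ.
by rewrite hornerD hornerN subr_ge0.
Qed.

Lemma step_majorant_ge0 {x : R} {P : {poly R}} :
  step_majorant c x P -> 0 <= moment_form s P.
Proof. by move=> hP; apply: s_pos.2 => t /hP; apply: le_trans. Qed.

Let lb0 x : has_lbound [set moment_form s P | P in step_majorant c x].
Proof. by exists 0 => _ [P hP <-]; exact: step_majorant_ge0 hP. Qed.

Let majorant1 x : step_majorant c x (1%:P : {poly R}).
Proof. by move=> t _; rewrite hornerC lern1 leq_b1. Qed.

Lemma poly_cdf_le {x : R} {P : {poly R}} :
  step_majorant c x P -> poly_cdf c s x <= moment_form s P.
Proof. by move=> hP; apply: ge_inf => //; exists P. Qed.

Lemma poly_cdf_ge {x y : R} :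
  (forall P, step_majorant c x P -> y <= moment_form s P) -> y <= poly_cdf c s x.
Proof.
move=> h; apply: lb_le_inf; first by exists (moment_form s 1%:P), 1%:P.
by move=> _ [P hP <-]; exact: h.
Qed.

Lemma poly_cdf_adherent (x : R) {e : R} : 0 < e ->
  exists2 P, step_majorant c x P & moment_form s P < poly_cdf c s x + e.
Proof.
move=> e0; have [] := inf_adherent e0
  (_ : has_inf [set moment_form s P | P in step_majorant c x]).
  by split=> //; exists (moment_form s 1%:P), 1%:P.
by move=> _ [P hP <-]; exists P.
Qed.

Lemma poly_cdf_ge0 x : 0 <= poly_cdf c s x.
Proof. by apply: poly_cdf_ge => P; exact: step_majorant_ge0. Qed.

Lemma poly_cdf_le1 x : poly_cdf c s x <= 1.
Proof. by apply: le_trans (poly_cdf_le (majorant1 x)) _; rewrite moment_form1. Qed.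

Lemma poly_cdf_lt0 x : x < 0 -> poly_cdf c s x = 0.
Proof.
move=> x0; apply/eqP; rewrite eq_le poly_cdf_ge0 andbT.
have h : step_majorant c x (0%:P : {poly R}).
  by move=> t /andP[t0 _]; rewrite hornerC (lt_geF (lt_le_trans x0 t0)).
by apply: le_trans (poly_cdf_le h) _; rewrite moment_form1.
Qed.

Lemma poly_cdf_ge_edge x : c <= x -> poly_cdf c s x = 1.
Proof.
move=> cx; apply/eqP; rewrite eq_le poly_cdf_le1 /=.
apply: poly_cdf_ge => P hP; rewrite -[1]moment_form1.
apply: ler_moment_form => t tc; rewrite hornerC; apply: le_trans (hP _ tc).
by case/andP: tc => _ tc; rewrite (le_trans tc cx).
Qed.

Lemma poly_cdf_nondecreasing : nondecreasing (poly_cdf c s).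
Proof.
move=> x y xy; apply: poly_cdf_ge => P hP; apply: poly_cdf_le => t tc.
apply: le_trans (hP _ tc); rewrite ler_nat.
by case: (leP t x) => // tx; rewrite (le_trans tx xy).
Qed.

(** A nearly optimal majorant [P] at [x] has [P.[x] >= 1], so by continuity [P + e / 2] is still a
    majorant at a point slightly to the right. *)
Lemma poly_cdf_right_continuous (x : R) : poly_cdf c s y @[y --> x^'+] --> poly_cdf c s x.
Proof.
apply/cvgrPdist_le => e e0.
suff [d d0 hd] : exists2 d, 0 < d & poly_cdf c s (x + d) <= poly_cdf c s x + e.
  near=> y; have xy : x <= y.
    by apply: ltW; near: y; exact: nbhs_right_gt.
  have yd : y <= x + d.
    by apply: ltW; near: y; apply: nbhs_right_lt; rewrite ltrDl.
  rewrite ler0_norm ?subr_le0 ?poly_cdf_nondecreasing// opprB lerBlDl.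
  exact: le_trans (poly_cdf_nondecreasing _ _ yd) hd.
(* [P.[x] >= 1] is available only for [x] in the segment. To its left the function is 0 up to
   [x / 2]; from [c] on it has its largest value. *)
have [x0|x0] := ltP x 0.
  exists (- x / 2); first by lra.
  by rewrite !poly_cdf_lt0 ?add0r ?(ltW e0)//; lra.
have [cx|xc] := leP c x.
  exists 1 => //; rewrite (poly_cdf_ge_edge _ cx); apply: le_trans (poly_cdf_le1 _) _.
  by rewrite lerDl ltW.
have e20 : 0 < e / 2 by lra.
have [P hP Pe] := poly_cdf_adherent x e20.
have : \forall t \near x, `|P.[x] - P.[t]| < e / 2.
  have : P.[t] @[t --> x] --> P.[x] by exact: continuous_horner.
  by move/cvgrPdist_lt => /(_ _ e20).
case=> d /= d0 hd; exists (d / 2); first by rewrite divr_gt0.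
apply: le_trans (_ : moment_form s (P + (e / 2)%:P) <= _); last first.
  by rewrite moment_formD moment_form1; lra.
apply: poly_cdf_le => t tc; rewrite hornerD hornerC.
have [tx|xt] := leP t x.
  apply: le_trans (_ : 1 <= _); first by rewrite lern1 leq_b1.
  by have := hP _ tc; rewrite tx mulr1n; lra.
case: (leP t (x + d / 2)) => [txd|_]; last first.
  by have := hP _ tc; rewrite (lt_geF xt) => h; rewrite addr_ge0// ltW.
have := hd t; rewrite /ball/= ltr0_norm ?subr_lt0// => /(_ _).
have -> : - (x - t) < d by lra.
move=> /(_ isT); rewrite ltr_norml => /andP[h1 h2].
have := hP x; rewrite lexx x0 (ltW xc) mulr1n => /(_ isT) h3.
by lra.
Unshelve. all: by end_near. Qed.

End poly_cdf.

(** * Moments are determined by the distribution function *)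

Section step_bounds.
Context {R : realDomainType} {x : nat -> R} {m : nat}.
Hypotheses (x0 : x 0%N = 0) (x_homo : {homo x : i j / (i <= j)%N >-> i <= j}).
Hypothesis m_gt0 : (0 < m)%N.

Let x_ge0 i : 0 <= x i. Proof. by rewrite -x0 x_homo. Qed.

(** [t ^ m] telescopes along the truncated nodes [Num.min (x i) t]; a step that starts below [t]
    contributes at most its full increment, the others nothing. *)
Lemma exprn_le_step (K : nat) (t : R) : 0 <= t <= x K ->
  t ^+ m <= \sum_(0 <= i < K) (x i.+1 ^+ m - x i ^+ m) * (1 - (t <= x i)%R%:R).
Proof.
move=> /andP[t0 tK].
have -> : t ^+ m = \sum_(0 <= i < K) (Num.min (x i.+1) t ^+ m - Num.min (x i) t ^+ m).
  rewrite (telescope_sumr (fun i => Num.min (x i) t ^+ m))//.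
  by rewrite x0 (min_r tK) (min_l t0) expr0n gtn_eqF// subr0.
apply: ler_sum => i _; have xi := x_homo _ _ (leqnSn i).
have [tx|] := boolP (t <= x i).
  by rewrite !min_r ?(le_trans tx xi)// !subrr mulr0.
rewrite -ltNge => xt; rewrite [X in _ - X ^+ m]min_l ?(ltW xt)// subr0 mulr1 lerD2r.
by rewrite lerXn2r ?nnegrE ?le_min ?x_ge0 ?ge_min ?lexx.
Qed.

Lemma step_le_exprn (K : nat) (t : R) : 0 <= t <= x K ->
  \sum_(0 <= i < K) (x i.+1 ^+ m - x i ^+ m) * (1 - (t <= x i.+1)%R%:R) <= t ^+ m.
Proof.
move=> /andP[t0 tK].
have -> : t ^+ m = \sum_(0 <= i < K) (Num.min (x i.+1) t ^+ m - Num.min (x i) t ^+ m).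
  rewrite (telescope_sumr (fun i => Num.min (x i) t ^+ m))//.
  by rewrite x0 (min_r tK) (min_l t0) expr0n gtn_eqF// subr0.
apply: ler_sum => i _; have xi := x_homo _ _ (leqnSn i).
have [tx|] := boolP (t <= x i.+1).
  rewrite subrr mulr0 subr_ge0 lerXn2r ?nnegrE ?le_min ?t0 ?x_ge0//.
  by rewrite !ge_min xi lexx orbT.
rewrite -ltNge => xt; rewrite !min_l ?(ltW xt) ?(ltW (le_lt_trans xi xt))//.
by rewrite subr0 mulr1.
Qed.

End step_bounds.

Section moment_bounds.
Context {R : realType} {c : R} {s : nat -> R} {x : nat -> R} {m K : nat}.
Hypotheses (c_gt0 : 0 < c) (s_pos : positive_moments c s) (m_gt0 : (0 < m)%N).
Hypotheses (x0 : x 0%N = 0) (xK : x K = c).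
Hypothesis x_homo : {homo x : i j / (i <= j)%N >-> i <= j}.

Let d i := x i.+1 ^+ m - x i ^+ m.

Let d_ge0 i : 0 <= d i.
Proof. by rewrite subr_ge0 lerXn2r ?nnegrE -?x0 ?x_homo. Qed.

Let sum_d : \sum_(0 <= i < K) d i = c ^+ m.
Proof.
by rewrite (telescope_sumr (fun i => x i ^+ m))// xK x0 expr0n gtn_eqF// subr0.
Qed.

(** A lower Stieltjes sum for the m-th moment: the indicators in [step_le_exprn] are replaced by
    nearly optimal polynomial majorants. *)
Lemma moment_ge_step :
  \sum_(0 <= i < K) d i * (1 - poly_cdf c s (x i.+1)) <= s m.
Proof.
apply/ler_addgt0Pr => e e0.
(* The weights [d i] add up to [c ^ m], so the total error is [e]. *)
have e'0 : 0 < e / c ^+ m by rewrite divr_gt0// exprn_gt0.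
have /choice[P hP] : forall i, exists P, step_majorant c (x i.+1) P /\
    moment_form s P < poly_cdf c s (x i.+1) + e / c ^+ m.
  by move=> i; have [P] := poly_cdf_adherent s_pos (x i.+1) e'0; exists P.
have : moment_form s (\sum_(0 <= i < K) d i *: (1%:P - P i)) <= moment_form s 'X^m.
  apply: (ler_moment_form s_pos) => t; rewrite -xK => tK.
  rewrite horner_sum !hornerE; apply: le_trans (step_le_exprn x0 x_homo m_gt0 _ _ tK).
  apply: ler_sum => i _; rewrite hornerZ; apply: ler_wpM2l; first exact: d_ge0.
  rewrite !hornerE lerD2l lerN2; apply: (hP i).1; by rewrite -xK.
rewrite moment_formXn moment_form_sum => h.
rewrite -lerBlDr; apply: le_trans h.
have -> : e = \sum_(0 <= i < K) d i * (e / c ^+ m).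
  by rewrite -mulr_suml sum_d mulrC divfK// gt_eqF// exprn_gt0.
rewrite -sumrB; apply: ler_sum => i _.
rewrite moment_formZ moment_formB (moment_form1 s_pos) -mulrBr ler_wpM2l//.
by have := (hP i).2; lra.
Qed.

(** An upper bound requires polynomials below an indicator, while [poly_cdf] is defined by
    majorants. A sharp polynomial between [x i - w] and [x i] serves both purposes up to [e'], at
    the price of the shift [w]. *)
Lemma moment_le_step (w : R) : 0 < w ->
  s m <= \sum_(0 <= i < K) d i * (1 - poly_cdf c s (x i - w)).
Proof.
move=> w0; apply/ler_addgt0Pr => e e0.
(* The error [e'] is spent twice: [Q i - e'] is below the step at [x i], and [Q i + e'] is above the
   step at [x i - w]. *)
pose e' := e / (2 * c ^+ m).
have e'0 : 0 < e' by rewrite divr_gt0// mulr_gt0// exprn_gt0.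
have xw i : x i - w < x i by lra.
have /choice[Q hQ] := fun i => exists_sharp_poly c_gt0 (xw i) e'0.
have : moment_form s 'X^m <= moment_form s (\sum_(0 <= i < K) d i *: ((1 + e')%:P - Q i)).
  apply: (ler_moment_form s_pos) => t tc.
  have tK : 0 <= t <= x K by rewrite xK.
  rewrite horner_sum !hornerE; apply: le_trans (exprn_le_step x0 x_homo m_gt0 _ _ tK) _.
  apply: ler_sum => i _; rewrite hornerZ; apply: ler_wpM2l; first exact: d_ge0.
  rewrite !hornerE; have [/andP[h0 h1] _ h2] := hQ i _ tc.
  by have [tx|/ltW /h2 xt] := leP t (x i); rewrite ?mulr0n ?mulr1n; lra.
rewrite moment_formXn moment_form_sum => /le_trans; apply.
have -> : e = \sum_(0 <= i < K) d i * (2 * e').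
  rewrite -mulr_suml sum_d /e'; field; rewrite expf_neq0// gt_eqF//.
rewrite -big_split; apply: ler_sum => i _ /=.
rewrite moment_formZ moment_formB (moment_form1 s_pos) -mulrDr ler_wpM2l//.
suff : poly_cdf c s (x i - w) <= moment_form s (Q i + e'%:P).
  by rewrite moment_formD (moment_form1 s_pos); lra.
apply: (poly_cdf_le s_pos) => t tc; rewrite !hornerE.
have [/andP[h0 h1] h2 _] := hQ i _ tc.
by have [/h2 tx|xt] := leP t (x i - w); rewrite ?mulr0n ?mulr1n; lra.
Qed.

End moment_bounds.

Lemma exprnB_le {R : realDomainType} {a b c : R} (m : nat) :
  0 <= a -> a <= b -> b <= c -> b ^+ m.+1 - a ^+ m.+1 <= m.+1%:R * c ^+ m * (b - a).
Proof.
move=> a0 ab bc; have b0 := le_trans a0 ab; have c0 := le_trans b0 bc.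
have ba : 0 <= b - a by rewrite subr_ge0.
elim: m => [|m ih]; first by rewrite expr0 !expr1 !mul1r.
have -> : b ^+ m.+2 - a ^+ m.+2 = b * (b ^+ m.+1 - a ^+ m.+1) + a ^+ m.+1 * (b - a).
  by rewrite (exprS b) (exprS a); ring.
rewrite -[m.+2%:R]natr1 2!mulrDl mul1r lerD//.
  apply: le_trans (ler_wpM2l b0 ih) _.
  rewrite exprS !mulrA ler_wpM2r// -!mulrA mulrCA ler_wpM2l//.
  by rewrite ler_wpM2r// exprn_ge0.
by rewrite ler_wpM2r// lerXn2r ?nnegrE// (le_trans ab).
Qed.

(** On a uniform partition the upper sum for [s] and the lower sum for [s'] involve the same
    distribution function and differ by a multiple of the mesh. Exchanging [s] and [s'] gives
    equality. *)
Lemma moment_le {R : realType} {c : R} {s s' : nat -> R} (m : nat) :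
  0 < c -> positive_moments c s -> positive_moments c s' ->
  poly_cdf c s =1 poly_cdf c s' -> s m <= s' m.
Proof.
move=> c0 s_pos s'_pos F; case: m => [|m]; first by rewrite s_pos.1 s'_pos.1.
apply/ler_addgt0Pr => e e0.
pose C := m.+1%:R * c ^+ m * c.
have C0 : 0 < C by rewrite !mulr_gt0// exprn_gt0.
have [k hk] : exists k : nat, 2 * C / e < k.+1%:R.
  by exists (Num.truncn (2 * C / e)); rewrite truncnS_gt.
set K := k.+1 in hk; have K0 : 0 < K%:R :> R by rewrite ltr0n.
pose w := c / K%:R; pose x i := w * i%:R.
have w0 : 0 < w by rewrite divr_gt0.
have x0 : x 0%N = 0 by rewrite /x mulr0.
have xK : x K = c by rewrite /x /w divfK// gt_eqF.
have xS i : x i.+1 - w = x i by rewrite /x -natr1; ring.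
have x_homo : {homo x : i j / (i <= j)%N >-> i <= j}.
  by move=> i j ij; rewrite /x ler_wpM2l ?ler_nat// ltW.
have h1 := moment_le_step c0 s_pos (ltn0Sn m) x0 xK x_homo w w0.
have h2 := moment_ge_step c0 s'_pos (ltn0Sn m) x0 xK x_homo.
apply: le_trans h1 _; rewrite -lerBlDl; apply: le_trans (lerB (lexx _) h2) _.
rewrite -sumrB; set D := m.+1%:R * c ^+ m * w.
have hF y : poly_cdf c s y = poly_cdf c s' y by exact: F.
have D0 : 0 <= D by rewrite !mulr_ge0 ?exprn_ge0 ?(ltW c0) ?(ltW w0).
apply: le_trans (_ : \sum_(0 <= i < K) D *
    (poly_cdf c s (x i.+1) - poly_cdf c s (x i - w)) <= _).
  rewrite big_nat [leRHS]big_nat; apply: ler_sum => i /andP[_ iK].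
  rewrite -mulrBr -hF.
  have -> (u v : R) : 1 - u - (1 - v) = v - u by ring.
  apply: ler_wpM2r.
    rewrite subr_ge0 (poly_cdf_nondecreasing s_pos)//.
    by apply: le_trans (_ : x i <= _); [lra|exact: x_homo].
  rewrite /D; have -> : w = x i.+1 - x i by rewrite -(xS i); ring.
  by apply: exprnB_le; rewrite -?x0 -?xK ?x_homo.
rewrite -mulr_sumr.
(* Each difference spans two meshes because [x i.+1 - w = x i], so the sum splits into two
   telescoping ones, each at most 1. *)
have -> : \sum_(0 <= i < K) (poly_cdf c s (x i.+1) - poly_cdf c s (x i - w)) =
    (poly_cdf c s (x K) - poly_cdf c s (x 0%N)) +
    (poly_cdf c s (x K - w) - poly_cdf c s (x 0%N - w)).
  rewrite -(telescope_sumr (fun i => poly_cdf c s (x i)))//.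
  rewrite -(telescope_sumr (fun i => poly_cdf c s (x i - w)))// -big_split /=.
  by apply: eq_bigr => i _; rewrite xS; ring.
apply: le_trans (_ : D * 2 <= _).
  apply: ler_wpM2l => //.
  have := poly_cdf_le1 s_pos (x K); have := poly_cdf_le1 s_pos (x K - w).
  by have := poly_cdf_ge0 s_pos (x 0%N); have := poly_cdf_ge0 s_pos (x 0%N - w); lra.
move: hk; rewrite ltr_pdivrMr// => hk.
have -> : D * 2 = 2 * C / K%:R by rewrite /D /C /w; ring.
by rewrite ler_pdivrMr// [e * _]mulrC ltW.
Qed.

(** * Probabilities concentrated on a segment *)

Section concentrated.
Context {R : realType} {c : R} (nu : probability (measurableTypeR R) R).
Hypothesis nuC : nu (~` `[0, c]) = 0.

Let I : set (measurableTypeR R) := `[0, c].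

Let mI : measurable I. Proof. exact: measurable_itv. Qed.

Lemma measurable_EFin_horner (P : {poly R}) (A : set (measurableTypeR R)) :
  measurable_fun A (fun x : measurableTypeR R => (P.[x])%:E).
Proof. by apply/measurable_EFinP; exact: measurable_poly. Qed.

(** Polynomials are bounded on the compact segment, whose complement is null. *)
Lemma horner_integrable (P : {poly R}) :
  nu.-integrable setT (fun x : measurableTypeR R => (P.[x])%:E).
Proof.
apply/(negligible_integrable (measurableC mI)) => //.
  exact: measurable_EFin_horner.
rewrite setTD setCK; apply: measurable_bounded_integrable => //.
- by apply: le_lt_trans (probability_le1 _ _) _; rewrite ?ltry.
- exact: measurable_poly.
- have [M [Mreal hM]] : bounded_set (horner P @` `[0, c] : set R^o).
    apply: compact_bounded; apply: continuous_compact; last exact: segment_compact.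
    by apply: continuous_subspaceT => x; exact: continuous_horner.
  by exists M; split => // y My x Ix; apply: hM My _ _; exists x.
Qed.

Lemma integral_horner_itv (P : {poly R}) :
  (\int[nu]_x (P.[x])%:E = \int[nu]_(x in I) (P.[x])%:E)%E.
Proof.
rewrite (negligible_integral (measurableC mI))//; first by rewrite setTD setCK.
exact: horner_integrable.
Qed.

Lemma integral_horner (s : nat -> R) (P : {poly R}) : has_moments nu s ->
  (\int[nu]_x (P.[x])%:E = (moment_form s P)%:E)%E.
Proof.
move=> hs; have hXn i : nu.-integrable setT (fun x : measurableTypeR R => (x ^+ i)%:E).
  by have := horner_integrable 'X^i; under eq_fun do rewrite hornerXn.
under eq_integral do rewrite horner_coef -sumEFin.
rewrite integral_sum//=; last first.
  move=> i; under eq_fun do rewrite EFinM.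
  by apply: integrableZl => //; exact: hXn.
rewrite moment_formE -sumEFin; apply: eq_bigr => i _.
under eq_integral do rewrite EFinM.
rewrite integralZl//.
by rewrite hs -EFinM mulrC.
Qed.

Lemma positive_moments_concentrated (s : nat -> R) :
  has_moments nu s -> positive_moments c s.
Proof.
move=> hs; split.
  apply: EFin_inj; rewrite -hs; under eq_integral do rewrite expr0.
  by rewrite integral_cst// mul1e; exact: probability_setT.
move=> P hP; rewrite -lee_fin -(integral_horner _ _ hs) integral_horner_itv.
by apply: integral_ge0 => x; rewrite /I /= in_itv/= lee_fin; exact: hP.
Qed.

Let nu_itv (x : R) :
  (nu `]-oo, x]%classic = \int[nu]_(t in I) (\1_(`]-oo, x]%classic) t)%:E)%E.
Proof.
rewrite integral_indic//.
rewrite -[in LHS](setIT `]-oo, x]%classic) -[in LHS](setUv I) setIUr measureU//.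
- rewrite [X in (_ + X)%E](_ : _ = 0) ?adde0//.
  apply/eqP; rewrite eq_le measure_ge0 andbT -nuC.
  apply: le_measure; rewrite ?inE//; last exact: measurableC mI.
  exact: measurableI (measurable_itv _) (measurableC mI).
- exact: measurableI.
- by apply: measurableI => //; exact: measurableC.
- by rewrite setIACA setICr setI0.
Qed.

Lemma nu_itv_le (s : nat -> R) (x : R) (P : {poly R}) : has_moments nu s ->
  step_majorant c x P -> (nu `]-oo, x]%classic <= (moment_form s P)%:E)%E.
Proof.
move=> hs hP; rewrite nu_itv -(integral_horner _ _ hs) integral_horner_itv.
apply: ge0_le_integral => //.
- by apply/measurable_EFinP; apply: measurable_indic; exact: measurable_itv.
- exact: measurable_EFin_horner.
- move=> t; rewrite /I /= in_itv/= => /hP; rewrite lee_fin indicE.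
  by rewrite mem_setE in_itv.
Qed.

Lemma nu_itv_ge (s : nat -> R) (x : R) (e : R) (P : {poly R}) : has_moments nu s ->
  0 <= e ->
  (forall t, 0 <= t <= c -> 0 <= P.[t] <= (t <= x)%R%:R + e) ->
  ((moment_form s P)%:E <= nu `]-oo, x]%classic + e%:E)%E.
Proof.
move=> hs e0 hP.
have -> : (nu `]-oo, x]%classic + e%:E =
    \int[nu]_(t in I) ((\1_(`]-oo, x]%classic) t)%:E + e%:E))%E.
  rewrite ge0_integralD//; last first.
    by apply/measurable_EFinP; apply: measurable_indic; exact: measurable_itv.
  rewrite integral_cst// -nu_itv; congr (_ + _)%E.
  have nuI : nu I = 1%E.
    by rewrite -[I]setCK probability_setC ?nuC ?sube0//; exact: measurableC.
  by rewrite [X in (_ = _ * X)%E](_ : _ = 1%E) ?mule1.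
rewrite -(integral_horner _ _ hs) integral_horner_itv.
apply: ge0_le_integral => //.
- by move=> t; rewrite /I /= in_itv/= => /hP /andP[]; rewrite lee_fin.
- exact: measurable_EFin_horner.
- apply: emeasurable_funD => //; apply/measurable_EFinP; apply: measurable_indic.
  exact: measurable_itv.
- move=> t; rewrite /I /= in_itv/= => /hP /andP[_]; rewrite -EFinD lee_fin indicE.
  by rewrite mem_setE in_itv.
Qed.

(** Every majorant integrates to at least the mass of the ray. Conversely, sharp polynomials between
    [x] and [y > x] bound [poly_cdf] by the mass up to [y], and [y] decreases to [x]. The ray masses
    thus depend on the moments alone. *)
Lemma cdf_concentrated (s : nat -> R) (x : R) : 0 < c -> has_moments nu s ->
  nu `]-oo, x]%classic = (poly_cdf c s x)%:E.
Proof.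
move=> c0 hs; have s_pos := positive_moments_concentrated _ hs.
have nufin y : nu `]-oo, y]%classic \is a fin_num by apply: fin_num_measure.
apply/eqP; rewrite eq_le; apply/andP; split.
  rewrite -[leLHS]fineK// lee_fin; apply: poly_cdf_ge => P hP.
  by rewrite -lee_fin fineK//; exact: nu_itv_le.
have hy y : x < y -> ((poly_cdf c s x)%:E <= nu `]-oo, y]%classic)%E.
  move=> xy; apply/lee_addgt0Pr => e e0.
  have e20 : 0 < e / 2 by rewrite divr_gt0.
  have [Q hQ] := exists_sharp_poly c0 xy e20.
  apply: (@le_trans _ _ (moment_form s (Q + (e / 2)%:P))%:E).
    rewrite lee_fin; apply: (poly_cdf_le s_pos) => t tc; rewrite !hornerE.
    have [/andP[h0 h1] h2 _] := hQ _ tc.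
    by have [/h2 tx|xt] := leP t x; rewrite ?mulr0n ?mulr1n; lra.
  apply: nu_itv_ge => //; first exact: ltW.
  move=> t tc; rewrite !hornerE.
  have [/andP[h0 h1] _ h2] := hQ _ tc.
  by have [ty|/ltW /h2 yt] := leP t y; rewrite ?mulr0n ?mulr1n; lra.
have cv : nu `]-oo, x + n.+1%:R^-1]%classic @[n --> \oo] --> nu `]-oo, x]%classic.
  rewrite [in X in _ --> X](itvNycEbigcap false).
  apply: nonincreasing_cvg_mu => [| | |m n mn].
  - by rewrite -ge0_fin_numE//; exact: nufin.
  - by move=> ?; exact: measurable_itv.
  - by apply: bigcap_measurable => // ? _; exact: measurable_itv.
  - apply/subsetPset; apply: subset_itvl.
    by rewrite bnd_simp lerD2l lef_pV2 ?posrE// ler_nat.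
rewrite -(cvg_lim _ cv)//; apply: lime_ge;
  first by apply/cvg_ex; exists (nu `]-oo, x]%classic).
by near=> n; apply: hy; rewrite ltrDl.
Unshelve. all: by end_near. Qed.

End concentrated.

(** By second countability: each point of [U] lies in a null interval with rational endpoints, and
    there are countably many of these. *)
Lemma open_off_mtsupp_null {R : realType}
    (nu : {measure set (measurableTypeR R) -> \bar R}) (U : set R) :
  open U -> (forall x, U x -> ~ mtsupp nu x) -> nu U = 0.
Proof.
move=> oU Usupp.
(* Enumerates the null rational intervals, with the empty set for codes of other intervals and for
   non-codes. *)
pose F n : set (measurableTypeR R) :=
  if @unpickle (rat * rat)%type n is Some q then
    if `[< nu `]ratr q.1, ratr q.2[%classic = 0 >] then `]ratr q.1, ratr q.2[%classic
    else set0
  else set0.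
have mF n : measurable (F n).
  rewrite /F; case: unpickle => [q|]; last exact: measurable0.
  by case: ifP => _; [exact: measurable_itv|exact: measurable0].
have nuF n : nu (F n) = 0.
  rewrite /F; case: unpickle => [q|]; last by rewrite measure0.
  by case: ifPn => [/asboolP //|_]; rewrite measure0.
have mU : measurable (U : set (measurableTypeR R)) by exact: open_measurable.
apply/negligibleP => //.
apply: (@negligibleS _ _ _ _ (\bigcup_n F n)); last first.
  by apply: negligible_bigcup => n; apply/negligibleP; [exact: mF|exact: nuF].
move=> x Ux; have /existsNP[V /not_implyP[oV /not_implyP[Vx nuV]]] := Usupp x Ux.
have {}nuV : nu V = 0.
  by apply/eqP; rewrite eq_le measure_ge0 andbT leNgt; apply/negP.
have mV : measurable (V : set (measurableTypeR R)) by exact: open_measurable.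
have /nbhs_ballP[e /= e0 eV] : nbhs x V by exact: open_nbhs_nbhs.
have [a /andP[a1 a2]] : exists q : rat, x - e < ratr q < x.
  by have [|q] := @rat_in_itvoo R (x - e) x; [rewrite gtrBl|rewrite in_itv /=; exists q].
have [b /andP[b1 b2]] : exists q : rat, x < ratr q < x + e.
  by have [|q] := @rat_in_itvoo R x (x + e); [rewrite ltrDl|rewrite in_itv /=; exists q].
have abV : `]ratr a, ratr b[%classic `<=` V.
  move=> y /=; rewrite in_itv/= => /andP[y1 y2]; apply: eV.
  by rewrite /ball/= ltr_distlC; apply/andP; split; lra.
exists (pickle (a, b)); first exact: I.
rewrite /F pickleK ifT; first by rewrite /= in_itv/= a2 b1.
apply/asboolP/eqP; rewrite eq_le measure_ge0 andbT -nuV.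
by apply: le_measure; rewrite ?inE//; exact: measurable_itv.
Qed.

(** The Lebesgue-Stieltjes measure of [poly_cdf c s] has moments [s'] with the same distribution
    function, so [moment_le] in both directions yields [s' = s]. *)
Lemma exists_moment_probability {R : realType} (c : R) (s : nat -> R) :
  0 < c -> positive_moments c s ->
  exists nu : probability (measurableTypeR R) R,
    nu (~` `[0, c]%classic) = 0 /\ has_moments nu s.
Proof.
move=> c0 s_pos; pose F := poly_cdf c s.
have FNy : F @ -oo --> (0 : R).
  apply: cvg_near_cst; near=> x; apply: (poly_cdf_lt0 s_pos).
  by near: x; exact: nbhs_ninfty_lt.
have Fy : F @ +oo --> (1 : R).
  apply: cvg_near_cst; near=> x; apply: (poly_cdf_ge_edge s_pos).
  by near: x; apply: nbhs_pinfty_ge; exact: num_real.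
pose f : cumulativeBounded (0 : R) (1 : R) := HB.pack F
  (isCumulative.Build R _ R F (poly_cdf_nondecreasing s_pos)
    (poly_cdf_right_continuous s_pos))
  (isCumulativeBounded.Build R 0 1 F FNy Fy).
pose nu : probability (measurableTypeR R) R := lebesgue_stieltjes_measure f.
have nuF x : nu `]-oo, x]%classic = (F x)%:E by exact: cdf_lebesgue_stieltjes_id f x.
have nuC : nu (~` `[0, c]%classic) = 0.
  (* The open negative ray is exhausted by closed rays, on which [F] gives mass 0. *)
  have -> : ~` `[0, c]%classic =
      `]c, +oo[%classic `|` \bigcup_n `]-oo, - n.+1%:R^-1 : R]%classic.
    apply/seteqP; split => x /=; rewrite in_itv/=.
      move/negP; rewrite negb_and -!ltNge => /orP[x0|cx]; last first.
        by left; rewrite in_itv/= cx.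
      right; exists (Num.truncn (- x^-1)) => //=; rewrite in_itv/=.
      have x'0 : 0 < - x by rewrite oppr_gt0.
      rewrite lerNr -[leRHS]invrK lef_pV2 ?posrE ?invr_gt0//.
      by rewrite -invrN ltW// invrN truncnS_gt.
    case=> [|[n _]] /=; rewrite in_itv/= ?andbT => h; apply/negP.
      by rewrite negb_and -!ltNge h orbT.
    rewrite negb_and -!ltNge; apply/orP; left; apply: le_lt_trans h _.
    by rewrite oppr_lt0 invr_gt0 ltr0n.
  apply/negligibleP.
    apply: measurableU; first exact: measurable_itv.
    by apply: bigcup_measurable => n _; exact: measurable_itv.
  apply: negligibleU.
    apply/negligibleP; first exact: measurable_itv.
    have : nu (~` `]-oo, c]%classic) = 0.
      rewrite probability_setC; last exact: measurable_itv.
      by rewrite nuF /F (poly_cdf_ge_edge s_pos) ?subee.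
    by rewrite setCitvl.
  apply: negligible_bigcup => n; apply/negligibleP; first exact: measurable_itv.
  by rewrite [LHS](nuF _) /F (poly_cdf_lt0 s_pos)// oppr_lt0 invr_gt0 ltr0n.
exists nu; split => //.
pose s' m := fine (\int[nu]_x (x ^+ m)%:E)%E.
have hs' : has_moments nu s'.
  move=> m; rewrite /s' fineK//.
  have := horner_integrable nu nuC 'X^m; under eq_fun do rewrite hornerXn.
  exact: integrable_fin_num.
have s'_pos := positive_moments_concentrated nu nuC _ hs'.
have ss' : poly_cdf c s =1 poly_cdf c s'.
  by move=> x; apply: EFin_inj; rewrite -(cdf_concentrated nu nuC _ x c0 hs') -/(F x) -nuF.
move=> m; rewrite hs'; congr (_%:E); apply/eqP; rewrite eq_le.
apply/andP; split; first by apply: (moment_le m c0 s'_pos s_pos) => x; rewrite ss'.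
exact: (moment_le m c0 s_pos s'_pos).
Unshelve. all: by end_near. Qed.

(** Half-open intervals are differences of rays; they are stable under intersection and generate the
    Borel sets, and []- n, n]] exhausts the line. *)
Lemma eq_probability_rays {R : realType}
    (nu nu' : probability (measurableTypeR R) R) :
  (forall x, nu `]-oo, x]%classic = nu' `]-oo, x]%classic) ->
  forall A : set (measurableTypeR R), measurable A -> nu A = nu' A.
Proof.
move=> rays; have nu_itv (mu : probability (measurableTypeR R) R) (a b : R) :
    a <= b -> mu `]a, b]%classic = (mu `]-oo, b]%classic - mu `]-oo, a]%classic)%E.
  move=> ab; have -> : `]a, b]%classic = `]-oo, b] `\` `]-oo, a] :> set R.
    by rewrite -[RHS]setCK setCD setCitvl setUC -[LHS]setCK setCitv.
  rewrite measureD ?setIidr//.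
  - exact: subset_itvl.
  - by rewrite -ge0_fin_numE//; apply: fin_num_measure; exact: measurable_itv.
move=> A; apply: (@measure_unique _ R (measurableTypeR R) (@ocitv R)
  (fun n => `]- n%:R, n%:R]%classic) _ _ _ _ nu nu') => //.
- exact: ocitvI.
- by move=> n; exact: is_ocitv.
- by rewrite (bigcup_itvT false false).
- move=> _ [[a b] _ <-] /=; have [ab|ba] := leP a b; last first.
    by rewrite set_itv_ge ?measure0// bnd_simp -leNgt ltW.
  by rewrite !nu_itv// !rays.
- by move=> n; apply: le_lt_trans (probability_le1 _ _) (ltry _); exact: measurable_itv.
Qed.

Theorem theorem3p4 (R : realType) (p r : R)
    (hp : 1 <= p) (hr : -1 <= r) (hrp : r <= p - 1) :
  exists_unique_probability (fun nu : probability (measurableTypeR R) R =>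
    mtsupp nu `<=` `[0, c_edge p] /\
    has_moments nu (fun m : nat => gbinom (m%:R * p + r) m)).
Proof.
have c0 := c_edge_gt0 p hp; set c := c_edge p in c0 *.
set s := fun m : nat => gbinom (m%:R * p + r) m.
have s_pos : positive_moments c s.
  split; last by move=> P; exact: moment_form_gbinom_ge0.
  by rewrite /s /gbinom big_ord0 fact0 divr1.
have oC : open (~` `[0, c]%classic : set R).
  by apply: closed_openC; exact: itv_closed.
have suppC (nu : probability (measurableTypeR R) R) :
    mtsupp nu `<=` `[0, c] -> nu (~` `[0, c]%classic) = 0.
  by move=> supp; apply: open_off_mtsupp_null => // x xC /supp.
have [nu [nuC hs]] := exists_moment_probability c s c0 s_pos.
exists nu; split.
  (* A point outside the segment has the open null complement as a neighbourhood. *)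
  split => // x xsupp; apply: contrapT => xc.
  have := xsupp _ oC xc.
  by rewrite [X in (_ < X)%E](_ : _ = 0%E) ?ltxx//; exact: nuC.
move=> nu' [/suppC nu'C hs'].
(* Both distribution functions equal [poly_cdf c s]. *)
apply: eq_probability_rays => x.
by rewrite (cdf_concentrated nu nuC _ x c0 hs) (cdf_concentrated nu' nu'C _ x c0 hs').
Qed.
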